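(* Let $a,b$ be positive integers with $a\le b$ and let $f^{a,b}_4(x,y,z,w)=ax^2+by^2+4(z^2+zw+w^2)$. If $f^{a,b}_4$ represents $1$, $2$ and $3$ (with integer arguments), then it represents every nonnegative integer. *)

(* Defs.v *)
From Stdlib Require Import ZArith.
Open Scope Z_scope.

Definition f4 (a b x y z w : Z) : Z :=
  a * x ^ 2 + b * y ^ 2 + 4 * (z ^ 2 + z * w + w ^ 2).

Definition represents (a b n : Z) : Prop :=
  exists x y z w : Z, f4 a b x y z w = n.

(* Main.v *)
Require Import Defs.
From Stdlib Require Import ZArith List Permutation Lia Bool.

(** Representing 1, 2 and 3 forces [a = 1] and [b = 2]. Since
    [4 (z^2 + z w + w^2)] takes the values [4 z^2] and [(2 z + 1)^2 + 3], it is
    enough to write every odd [m > 0] as [x^2 + 2 y^2 + 4 z^2], equivalently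
    [2 m = a^2 + b^2 + c^2] with [a, b] odd and [c] even. This follows from a
    class number formula: the number of such [(a, b, c)], with [a, b] normalised
    to be [1 mod 4], equals the number of [p >= 1, q >= 0, c >= 1] with
    [2 p q + c (p + q) = m], which is positive because of [(1, 0, m)].

    Write [R m] and [G m] for the two counts. The values at odd [m] are determined
    by the sums over all integers [t] of [R (m - 2 t^2)], resp. [G (m - 2 t^2)],
    and both sums equal the divisor sum [sigma m].
    - For [R] this is Jacobi's theorem that [4 m] has [sigma m] representations
      as a sum of four squares of integers that are [1 mod 4]. The recursion
      [sum_x (N - 4 x^2) r (N) = 0], [N = n - x^2], [x = 1 mod 4], determines [r];
      it holds for the number of representations since the five squares in
      [n = x^2 + a^2 + b^2 + c^2 + d^2] play symmetric roles, and for [sigma]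
      by an involution on the solutions of [x^2 + 4 d e = n].
    - For [G] the sum counts solutions of a quaternary equation, which are
      transformed by linear substitutions until only [N (c + 2 j) = m] is left. *)

Open Scope Z_scope.

(* Sums range over a box of side [2 B + 1], with [B] fixed and large enough for all
   the finitely many solutions of the equations under consideration. *)
Class Boxed (A : Type) := {
  box : Z -> list A;
  in_box : Z -> A -> Prop;
  box_NoDup : forall B, NoDup (box B);
  box_spec : forall B x, In x (box B) <-> in_box B x }.

Definition interval (B : Z) : list Z :=
  map (fun i => Z.of_nat i - B) (seq 0 (Z.to_nat (2 * B + 1))).

Lemma interval_NoDup B : NoDup (interval B).
Proof.
apply FinFun.Injective_map_NoDup; [intros i j; lia | apply seq_NoDup].
Qed.

Lemma interval_spec B x : In x (interval B) <-> - B <= x <= B.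
Proof.
unfold interval; rewrite in_map_iff; split.
- intros [i [<- Hi]]; apply in_seq in Hi; lia.
- intros Hx; exists (Z.to_nat (x + B)); rewrite in_seq; lia.
Qed.

#[export] Instance Boxed_Z : Boxed Z :=
  { box := interval; in_box B x := - B <= x <= B;
    box_NoDup := interval_NoDup; box_spec := interval_spec }.

Lemma list_prod_NoDup {A C} (l : list A) (l' : list C) :
  NoDup l -> NoDup l' -> NoDup (list_prod l l').
Proof.
intros Hl Hl'; induction Hl as [|a l Ha _ IH]; simpl; [constructor|].
apply NoDup_app; [|exact IH|].
- apply FinFun.Injective_map_NoDup; [congruence | exact Hl'].
- intros [b c]; rewrite in_map_iff, in_prod_iff.
  intros [x [E _]] [Hb _]; congruence.
Qed.

#[export] Program Instance Boxed_prod {A C} {HA : Boxed A} {HC : Boxed C} :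
  Boxed (A * C) :=
  { box B := list_prod (box B) (box B);
    in_box B x := in_box B (fst x) /\ in_box B (snd x) }.
Next Obligation. apply list_prod_NoDup; apply box_NoDup. Qed.
Next Obligation. rewrite in_prod_iff, !box_spec; reflexivity. Qed.

(** * Filtered sums and counts over lists and boxes *)

Definition lsum {A} (l : list A) (P : A -> bool) (F : A -> Z) : Z :=
  fold_right (fun x s => (if P x then F x else 0) + s) 0 l.

Definition bsum {A} {HA : Boxed A} (B : Z) (P : A -> bool) (F : A -> Z) : Z :=
  lsum (box B) P F.

Notation count B P := (bsum B P (fun _ => 1)).

Lemma lsum_perm {A} (l l' : list A) P (F : A -> Z) :
  Permutation l l' -> lsum l P F = lsum l' P F.
Proof. unfold lsum; induction 1; simpl; lia. Qed.

Lemma lsum_filter {A} (l : list A) P (F : A -> Z) :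
  lsum l P F = lsum (filter P l) (fun _ : A => true) F.
Proof.
unfold lsum; induction l as [|x l IH]; simpl; [easy|].
destruct (P x); simpl; lia.
Qed.

Lemma lsum_map {A C} (f : A -> C) (l : list A) (F : C -> Z) :
  lsum (map f l) (fun _ : C => true) F = lsum l (fun _ : A => true) (fun x => F (f x)).
Proof. unfold lsum; induction l as [|x l IH]; simpl; congruence. Qed.

Lemma lsum_ext {A} (l : list A) (P Q : A -> bool) (F G : A -> Z) :
  (forall x, In x l -> (if P x then F x else 0) = (if Q x then G x else 0)) ->
  lsum l P F = lsum l Q G.
Proof.
intros H; unfold lsum; induction l as [|x l IH]; simpl; [easy|].
rewrite H, IH; simpl; auto. intros y Hy; apply H; simpl; auto.
Qed.

Lemma lsum_app {A} (l l' : list A) P (F : A -> Z) :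
  lsum (l ++ l') P F = lsum l P F + lsum l' P F.
Proof. unfold lsum; induction l as [|x l IH]; simpl; lia. Qed.

(** Carries all the changes of variables below. The maps [f] and [g] need to be mutually inverse
    only between the solution sets, so they may involve divisions and case distinctions that mean
    nothing elsewhere. *)
Lemma bsum_reindex {A C} {HA : Boxed A} {HC : Boxed C} (f : A -> C) (g : C -> A)
    B (P : A -> bool) (Q : C -> bool) (F : A -> Z) (G : C -> Z) :
  (forall x, P x = true -> in_box B x) ->
  (forall y, Q y = true -> in_box B y) ->
  (forall x, P x = true -> Q (f x) = true /\ g (f x) = x /\ G (f x) = F x) ->
  (forall y, Q y = true -> P (g y) = true /\ f (g y) = y) ->
  bsum B P F = bsum B Q G.
Proof.
intros HP HQ Hf Hg; unfold bsum.
rewrite (lsum_filter _ P), (lsum_filter _ Q).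
transitivity (lsum (map f (filter P (box B))) (fun _ : C => true) G).
{ rewrite lsum_map; apply lsum_ext; intros x; rewrite filter_In.
  intros [_ Hx]; symmetry; apply Hf, Hx. }
apply lsum_perm, NoDup_Permutation.
- assert (Hn : NoDup (filter P (box B))) by apply NoDup_filter, box_NoDup.
  apply NoDup_map_NoDup_ForallPairs; [|exact Hn].
  intros x y Hx Hy E; apply filter_In in Hx, Hy.
  destruct (Hf x (proj2 Hx)) as [_ [<- _]], (Hf y (proj2 Hy)) as [_ [<- _]].
  congruence.
- apply NoDup_filter, box_NoDup.
- intros y; rewrite in_map_iff, filter_In, box_spec; split.
  + intros [x [<- Hx]]; apply filter_In in Hx.
    split; [apply HQ|]; apply Hf, Hx.
  + intros [_ Hy]; destruct (Hg y Hy) as [H1 H2].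
    exists (g y); rewrite filter_In, box_spec; auto.
Qed.

Lemma bsum_ext {A} {HA : Boxed A} B (P Q : A -> bool) (F G : A -> Z) :
  (forall x, (if P x then F x else 0) = (if Q x then G x else 0)) ->
  bsum B P F = bsum B Q G.
Proof. intros H; apply lsum_ext; auto. Qed.

Lemma bsum_ext_pred {A} {HA : Boxed A} B (P Q : A -> bool) (F : A -> Z) :
  (forall x, P x = true <-> Q x = true) -> bsum B P F = bsum B Q F.
Proof.
intros H; apply bsum_ext; intros x; specialize (H x).
destruct (P x), (Q x); intuition congruence.
Qed.

Lemma bsum_add {A} {HA : Boxed A} B (P : A -> bool) (F G : A -> Z) :
  bsum B P (fun x => F x + G x) = bsum B P F + bsum B P G.
Proof.
unfold bsum, lsum; induction (box B) as [|x l IH]; simpl; [easy|].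
destruct (P x); lia.
Qed.

Lemma bsum_mul {A} {HA : Boxed A} B P c (F : A -> Z) :
  bsum B P (fun x => c * F x) = c * bsum B P F.
Proof.
unfold bsum, lsum; induction (box B) as [|x l IH]; simpl; [lia|].
destruct (P x); lia.
Qed.

Lemma bsum_opp {A} {HA : Boxed A} B (P : A -> bool) (F : A -> Z) :
  bsum B P (fun x => - F x) = - bsum B P F.
Proof.
unfold bsum, lsum; induction (box B) as [|x l IH]; simpl; [lia|].
destruct (P x); lia.
Qed.

Lemma bsum_split {A} {HA : Boxed A} (Q : A -> bool) B (P : A -> bool) (F : A -> Z) :
  bsum B P F = bsum B (fun x => P x && Q x) F + bsum B (fun x => P x && negb (Q x)) F.
Proof.
unfold bsum, lsum; induction (box B) as [|x l IH]; simpl; [easy|].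
destruct (P x), (Q x); simpl; lia.
Qed.

Lemma bsum_pair {A C} {HA : Boxed A} {HC : Boxed C} B P (F : A * C -> Z) :
  bsum B P F =
  bsum B (fun _ => true) (fun a => bsum B (fun c => P (a, c)) (fun c => F (a, c))).
Proof.
unfold bsum; simpl; generalize (box B : list A); intros l.
induction l as [|a l IH]; simpl; [easy|].
rewrite lsum_app, IH; unfold lsum at 3; simpl; fold (@lsum A l). f_equal.
generalize (box B : list C); intros l'.
unfold lsum; induction l' as [|c l' IH']; simpl; [easy|]. now rewrite IH'.
Qed.

(** The other terms may satisfy [P] as long as their weight vanishes; this isolates one term of a
    recursion when induction kills the rest. *)
Lemma bsum_single {A} {HA : Boxed A} a B (P : A -> bool) (F : A -> Z) :
  in_box B a -> (forall x, P x = true -> x <> a -> F x = 0) ->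
  bsum B P F = if P a then F a else 0.
Proof.
intros Ha H; apply box_spec in Ha; unfold bsum.
destruct (in_split _ _ Ha) as [l1 [l2 E]].
assert (Hn := box_NoDup B); rewrite E in *.
assert (Hz : forall l, ~ In a l -> lsum l P F = 0).
{ intros l Hl; induction l as [|x l IH]; [easy|]; simpl.
  unfold lsum in *; simpl; rewrite IH by (simpl in Hl; tauto).
  destruct (P x) eqn:Px; [rewrite H|]; auto. intros ->; apply Hl; simpl; auto. }
assert (Hn' := NoDup_remove_2 _ _ _ Hn); rewrite in_app_iff in Hn'.
rewrite lsum_app, Hz by tauto; change (a :: l2) with ((a :: nil) ++ l2).
rewrite lsum_app, (Hz l2) by tauto. unfold lsum; simpl; lia.
Qed.

Lemma bsum_zero {A} {HA : Boxed A} B (P : A -> bool) (F : A -> Z) :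
  (forall x, P x = true -> F x = 0) -> bsum B P F = 0.
Proof.
intros H; unfold bsum, lsum; induction (box B) as [|x l IH]; simpl; [easy|].
rewrite IH; destruct (P x) eqn:E; [rewrite H|]; auto.
Qed.

Lemma count_pos {A} {HA : Boxed A} a B (P : A -> bool) :
  in_box B a -> P a = true -> 0 < count B P.
Proof.
intros Ha Pa; apply box_spec in Ha; unfold bsum, lsum.
assert (N : forall l, 0 <= fold_right (fun x s => (if P x then 1 else 0) + s) 0 l).
{ induction l as [|x l IH]; simpl; [|destruct (P x)]; lia. }
induction (box B) as [|x l IH]; simpl; [easy|].
destruct Ha as [->|Ha]; [rewrite Pa; specialize (N l); lia|].
specialize (IH Ha); destruct (P x); lia.
Qed.

(** Together with [count_pos], lets an equality of two counts transfer the existence of a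
    solution. *)
Lemma count_witness {A} {HA : Boxed A} B (P : A -> bool) :
  0 < count B P -> exists a, P a = true.
Proof.
intros H. unfold bsum, lsum in H; induction (box B) as [|x l IH]; simpl in H; [easy|].
destruct (P x) eqn:E; eauto.
Qed.

(** * Automation and elementary facts on squares *)

Ltac Zify.zify_post_hook ::= Z.to_euclidean_division_equations.

Ltac b2p := repeat rewrite ?andb_true_iff, ?negb_true_iff, ?Z.ltb_lt, ?Z.ltb_ge,
  ?Z.leb_le, ?Z.leb_gt, ?Z.eqb_eq, ?Z.eqb_neq in *.

Ltac pair_eq := repeat match goal with |- (_, _) = (_, _) => apply f_equal2 end; lia.

Lemma sqr_mod8 y : y mod 2 = 1 -> (y * y) mod 8 = 1.
Proof.
intros Hy; set (q := y / 2).
assert (E : y * y = 4 * (q * (q + 1)) + 1)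
  by (replace y with (2 * q + 1) by lia; ring).
assert (Ht : (q * (q + 1)) mod 2 = 0).
{ rewrite Z.mul_mod, (Z.add_mod q 1) by lia.
  destruct (Z.mod_pos_bound q 2 ltac:(lia)).
  assert (C : q mod 2 = 0 \/ q mod 2 = 1) by lia.
  destruct C as [-> | ->]; reflexivity. }
rewrite E; lia.
Qed.

Lemma sqr_bound x : 0 <= x * x /\ - (x * x) <= x <= x * x.
Proof. nia. Qed.

Lemma odd_of_sqr x : (x * x) mod 2 = 1 -> x mod 2 = 1.
Proof.
intros H; destruct (Z.eq_dec (x mod 2) 0) as [E | E]; [exfalso | lia].
assert (x * x = 2 * (2 * (x / 2) * (x / 2))) by (rewrite (Z.div_mod x 2), E at 1 2; [ring | lia]).
lia.
Qed.

(** * Four squares *)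

Definition quad_triple (n : Z) : Z * (Z * Z) -> bool :=
  fun '(x, (d, e)) => (0 <? d) && (0 <? e) && (x * x + 4 * d * e =? n).

Lemma quad_triple_in_box B n v : n <= B -> quad_triple n v = true -> in_box B v.
Proof.
destruct v as [x [d e]]; unfold quad_triple; intros HB H; b2p; simpl; nia.
Qed.

(** If [x = d - e], then [n = (d - e)^2 + 4 d e = (d + e)^2], but 5 is not a square modulo 8. *)
Lemma quad_triple_side n x d e :
  n mod 8 = 5 -> quad_triple n (x, (d, e)) = true -> d - x - e <> 0.
Proof.
unfold quad_triple; intros Hn H E; b2p.
assert (Hs : (d + e) * (d + e) = n) by nia.
assert (C : (d + e) mod 2 = 0 \/ (d + e) mod 2 = 1)
  by (pose proof (Z.mod_pos_bound (d + e) 2); lia).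
destruct C as [C | C].
- rewrite (Z.div_mod (d + e) 2), C in Hs by lia.
  assert (n mod 2 = 0) by (rewrite <- Hs, Z.add_0_r, <- Z.mul_assoc, Z.mul_comm; apply Z.mod_mul; lia).
  lia.
- apply sqr_mod8 in C; lia.
Qed.

Lemma divisor_recursion_all B n :
  n mod 8 = 5 -> n <= B ->
  bsum B (quad_triple n) (fun '(x, (d, e)) => (d * e - x * x) * d) = 0.
Proof.
intros Hn HB.
assert (HP : forall v, quad_triple n v = true -> in_box B v)
  by (intros; eapply quad_triple_in_box; eauto).
set (f := fun '(x, (d, e)) => (d * e - x * x) * d : Z).
set (f' := fun '(x, (d, e)) => (d * e - x * x) * e : Z).
set (g := fun '(x, (d, e)) => x * (d * d - e * e) : Z).
assert (Hf : bsum B (quad_triple n) f = bsum B (quad_triple n) f').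
{ apply (bsum_reindex (fun '(x, (d, e)) => (x, (e, d))) (fun '(x, (d, e)) => (x, (e, d))));
    auto; intros [x [d e]]; unfold quad_triple, f, f'; intros H; b2p; repeat split; lia. }
assert (Hg : bsum B (quad_triple n) g = bsum B (quad_triple n) (fun v => - g v)).
{ apply (bsum_reindex (fun '(x, (d, e)) => (- x, (d, e))) (fun '(x, (d, e)) => (- x, (d, e))));
    auto; intros [x [d e]]; unfold quad_triple, g; intros H; b2p;
    repeat split; try lia; pair_eq. }
rewrite bsum_opp in Hg.
(* With [k = d - x - e], this is [(d + e) (d - k) (k + e)]: it changes sign when
   [d] and [k] are exchanged, and up to terms that sum to 0 it is [f + f']. *)
set (h := fun '(x, (d, e)) => (d + e) * (d - (d - x - e)) * (d - x - e + e) : Z).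
assert (Eh : bsum B (quad_triple n) h =
             bsum B (quad_triple n) f + bsum B (quad_triple n) f' + bsum B (quad_triple n) g).
{ rewrite <- !bsum_add; apply bsum_ext; intros [x [d e]]; unfold h, f, f', g.
  destruct (quad_triple n (x, (d, e))); ring. }
set (Sp := fun v : Z * (Z * Z) => quad_triple n v && (let '(x, (d, e)) := v in 0 <? d - x - e)).
(* Write [k = d - x - e]. Exchanging [d] and [k] with [e] fixed turns [x = d - k - e] into
   [k - d - e = - x - 2 e], and preserves [x^2 + 4 d e]. *)
assert (Hn' : bsum B Sp h = bsum B Sp (fun v => - h v)).
{ apply (bsum_reindex (fun '(x, (d, e)) => (- x - 2 * e, (d - x - e, e)))
                      (fun '(x, (d, e)) => (- x - 2 * e, (d - x - e, e)))).
  1, 2: intros v Hv; apply HP; unfold Sp in Hv; b2p; tauto.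
  all: intros [x [d e]]; unfold Sp, h, quad_triple; intros H; b2p;
    repeat split; try lia; pair_eq. }
rewrite bsum_opp in Hn'.
rewrite (bsum_split (fun '(x, (d, e)) => 0 <? d - x - e)) in Eh.
(* This reflection negates [k] and fixes [h]. As [k] is never 0, the half with [k < 0] contributes
   the same as the half with [k > 0]. *)
assert (Hs : bsum B (fun v => quad_triple n v && negb (let '(x, (d, e)) := v in 0 <? d - x - e)) h
             = bsum B Sp h).
{ apply (bsum_reindex (fun '(x, (d, e)) => (- x, (e, d))) (fun '(x, (d, e)) => (- x, (e, d)))).
  1, 2: intros v Hv; apply HP; unfold Sp in Hv; b2p; tauto.
  - intros [x [d e]] H; b2p; destruct H as [H1 H2].
    pose proof (quad_triple_side n x d e Hn H1).
    unfold Sp, h, quad_triple in *; b2p; repeat split; try lia; pair_eq.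
  - intros [x [d e]]; unfold Sp, quad_triple; intros H; b2p;
    repeat split; try lia; pair_eq. }
change (bsum B (fun v => quad_triple n v && (let '(x, (d, e)) := v in 0 <? d - x - e)) h)
  with (bsum B Sp h) in Eh.
lia.
Qed.

(** For [B] large enough this is [sigma (N / 4)], read as 0 unless [N] is a positive multiple of
    4. *)
Definition divisor_sum (B N : Z) : Z :=
  bsum B (fun '(d, e) => (0 <? d) && (0 <? e) && (4 * d * e =? N)) (fun '(d, e) => d).

Definition four_squares (N : Z) : Z * Z * Z * Z -> bool :=
  fun '(a, b, c, d) => (a mod 4 =? 1) && (b mod 4 =? 1) && (c mod 4 =? 1) && (d mod 4 =? 1)
    && (a * a + b * b + c * c + d * d =? N).

(** On [n - x^2 = 4 d e] the factor [n - 5 x^2] equals [4 (d e - x^2)], the weight of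
    [divisor_recursion_all]. Since [n] is odd, so is [x], and [x -> - x] exchanges the classes 1 and
    3 modulo 4; each of them carries half of a sum that is 0. *)
Lemma divisor_recursion B n :
  n mod 8 = 5 -> n <= B ->
  bsum B (fun x => x mod 4 =? 1)
    (fun x => (n - x * x - 4 * (x * x)) * divisor_sum B (n - x * x)) = 0.
Proof.
intros Hn HB.
assert (HP : forall v, quad_triple n v = true -> in_box B v)
  by (intros; eapply quad_triple_in_box; eauto).
set (f := fun '(x, (d, e)) => (d * e - x * x) * d : Z).
set (Q := fun v : Z * (Z * Z) => let '(x, (d, e)) := v in x mod 4 =? 1).
assert (Hf := divisor_recursion_all B n Hn HB); fold f in Hf.
rewrite (bsum_split Q) in Hf.
assert (Hs : bsum B (fun v => quad_triple n v && Q v) f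
             = bsum B (fun v => quad_triple n v && negb (Q v)) f).
{ apply (bsum_reindex (fun '(x, (d, e)) => (- x, (d, e))) (fun '(x, (d, e)) => (- x, (d, e)))).
  1, 2: intros v Hv; apply HP; b2p; tauto.
  - intros [x [d e]]; unfold Q, f, quad_triple; intros H; b2p;
      repeat split; try lia; pair_eq.
  - intros [x [d e]]; unfold Q, f, quad_triple; intros H; b2p.
    assert (x mod 2 = 1) by (apply odd_of_sqr; lia).
    repeat split; try lia; pair_eq. }
transitivity (4 * bsum B (fun v => quad_triple n v && Q v) f); [|lia].
rewrite <- bsum_mul, bsum_pair.
apply bsum_ext; intros x; unfold divisor_sum, Q, f, quad_triple.
rewrite <- bsum_mul.
destruct (x mod 4 =? 1) eqn:E.
- apply bsum_ext; intros [d e]; rewrite andb_true_r.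
  destruct (0 <? d), (0 <? e); cbn [andb]; auto.
  destruct (Z.eqb_spec (4 * d * e) (n - x * x)), (Z.eqb_spec (x * x + 4 * d * e) n); lia.
- symmetry; apply bsum_zero; intros [d e]; rewrite andb_false_r; discriminate.
Qed.

(** In [n = x^2 + a^2 + b^2 + c^2 + d^2] all five squares have the same total over the solutions, so
    [a^2 + b^2 + c^2 + d^2 - 4 x^2] sums to 0. *)
Lemma four_squares_recursion B n :
  0 <= n <= B ->
  bsum B (fun x => x mod 4 =? 1)
    (fun x => (n - x * x - 4 * (x * x)) * count B (four_squares (n - x * x))) = 0.
Proof.
intros HB.
set (P := fun '(x, (a, b, c, d)) => (x mod 4 =? 1) && four_squares (n - x * x) (a, b, c, d)).
set (s0 := fun v : Z * (Z * Z * Z * Z) => let '(x, (a, b, c, d)) := v in x * x).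
set (s1 := fun v : Z * (Z * Z * Z * Z) => let '(x, (a, b, c, d)) := v in a * a).
set (s2 := fun v : Z * (Z * Z * Z * Z) => let '(x, (a, b, c, d)) := v in b * b).
set (s3 := fun v : Z * (Z * Z * Z * Z) => let '(x, (a, b, c, d)) := v in c * c).
set (s4 := fun v : Z * (Z * Z * Z * Z) => let '(x, (a, b, c, d)) := v in d * d).
assert (HP : forall v, P v = true -> in_box B v).
{ intros [x [[[a b] c] d]]; unfold P, four_squares; intros H; b2p; simpl.
  destruct H as [_ [_ H]].
  pose proof (sqr_bound x); pose proof (sqr_bound a); pose proof (sqr_bound b);
  pose proof (sqr_bound c); pose proof (sqr_bound d); lia. }
assert (H1 : bsum B P s0 = bsum B P s1).
{ apply (bsum_reindex (fun '(x, (a, b, c, d)) => (a, (x, b, c, d)))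
    (fun '(x, (a, b, c, d)) => (a, (x, b, c, d)))); auto;
  intros [x [[[a b] c] d]]; unfold P, four_squares; intros H; b2p; repeat split; lia. }
assert (H2 : bsum B P s0 = bsum B P s2).
{ apply (bsum_reindex (fun '(x, (a, b, c, d)) => (b, (a, x, c, d)))
    (fun '(x, (a, b, c, d)) => (b, (a, x, c, d)))); auto;
  intros [x [[[a b] c] d]]; unfold P, four_squares; intros H; b2p; repeat split; lia. }
assert (H3 : bsum B P s0 = bsum B P s3).
{ apply (bsum_reindex (fun '(x, (a, b, c, d)) => (c, (a, b, x, d)))
    (fun '(x, (a, b, c, d)) => (c, (a, b, x, d)))); auto;
  intros [x [[[a b] c] d]]; unfold P, four_squares; intros H; b2p; repeat split; lia. }
assert (H4 : bsum B P s0 = bsum B P s4).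
{ apply (bsum_reindex (fun '(x, (a, b, c, d)) => (d, (a, b, c, x)))
    (fun '(x, (a, b, c, d)) => (d, (a, b, c, x)))); auto;
  intros [x [[[a b] c] d]]; unfold P, four_squares; intros H; b2p; repeat split; lia. }
transitivity (bsum B P (fun v => (s1 v + s2 v + s3 v + s4 v) + (-4) * s0 v)).
2: { rewrite bsum_add, !bsum_add, bsum_mul; lia. }
rewrite bsum_pair; apply bsum_ext; intros x.
rewrite <- bsum_mul; destruct (x mod 4 =? 1) eqn:E.
- apply bsum_ext; intros [[[a b] c] d]; unfold P, s0, s1, s2, s3, s4; rewrite E; cbn [andb].
  destruct (four_squares (n - x * x) (a, b, c, d)) eqn:F; [|easy].
  unfold four_squares in F; b2p; lia.
- symmetry; apply bsum_zero; intros [[[a b] c] d]; unfold P; rewrite E; discriminate.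
Qed.

(** For [n = 4 m + 1] the term [x = 1] is [(4 m - 4) H (4 m)]. For any other [x], [x^2 = 1 mod 8]
    makes [n - x^2] four times a smaller odd number, covered by induction. The coefficient vanishes
    at [m = 1], which is why [H 4] has to be given. *)
Lemma recursion_unique (B : Z) (H : Z -> Z) :
  (forall n, n mod 8 = 5 -> 0 <= n <= B ->
     bsum B (fun x => x mod 4 =? 1) (fun x => (n - x * x - 4 * (x * x)) * H (n - x * x)) = 0) ->
  (forall N, N <= 0 -> H N = 0) -> H 4 = 0 ->
  forall m, m mod 2 = 1 -> 4 * m + 1 <= B -> H (4 * m) = 0.
Proof.
intros Hrec Hneg H4 m.
destruct (Z.le_gt_cases m 0) as [Hm | Hm]; [intros; apply Hneg; lia|].
assert (Hm0 : 0 <= m) by lia; revert Hm.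
pattern m; apply Zlt_0_ind; [clear m Hm0; intros m IH _ Hm Hodd HB | exact Hm0].
destruct (Z.eq_dec m 1) as [-> | Hm1]; [exact H4|].
assert (E := Hrec (4 * m + 1) ltac:(lia) ltac:(lia)).
rewrite (bsum_single 1) in E; [|simpl; lia|].
- replace (4 * m + 1 - 1 * 1) with (4 * m) in E by lia.
  change (1 mod 4 =? 1) with true in E; cbn iota in E.
  apply Z.mul_eq_0 in E; lia.
- intros x Hx Hx1; b2p.
  assert (Hs := sqr_mod8 x ltac:(lia)).
  assert (9 <= x * x) by (assert (3 <= x \/ x <= -3) by lia; clear Hx; nia).
  destruct (Z.le_gt_cases (4 * m + 1 - x * x) 0); [rewrite Hneg by lia; ring|].
  replace (4 * m + 1 - x * x) with (4 * ((4 * m + 1 - x * x) / 4)) by lia.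
  rewrite IH by lia; ring.
Qed.

Lemma sqr_mod4_bound a : a mod 4 = 1 -> 1 <= a * a /\ (a * a = 1 -> a = 1).
Proof.
intros Ha; assert (H : a = 1 \/ a <= -3 \/ 5 <= a) by lia; clear Ha; nia.
Qed.

Lemma four_squares_bound N a b c d :
  four_squares N (a, b, c, d) = true ->
  4 <= N /\ (N = 4 -> (a, b, c, d) = (1, 1, 1, 1)).
Proof.
unfold four_squares; intros H; b2p.
destruct H as [[[[Ha Hb] Hc] Hd] E].
apply sqr_mod4_bound in Ha, Hb, Hc, Hd.
split; [lia | intros ->].
repeat f_equal; [apply Ha | apply Hb | apply Hc | apply Hd]; lia.
Qed.

Lemma four_squares_divisor_sum B m :
  m mod 2 = 1 -> 5 <= B -> 4 * m + 1 <= B ->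
  count B (four_squares (4 * m)) = divisor_sum B (4 * m).
Proof.
intros Hm HB4 HB.
cut ((fun N => count B (four_squares N) + - divisor_sum B N) (4 * m) = 0); [simpl; lia|].
apply (recursion_unique B (fun N => count B (four_squares N) + - divisor_sum B N)); auto.
- intros n Hn Hn'.
  assert (E1 := four_squares_recursion B n Hn').
  assert (E2 := divisor_recursion B n Hn ltac:(lia)).
  match type of E1 with ?l = _ => match type of E2 with ?r = _ =>
    transitivity (l + - r); [| rewrite E1, E2; reflexivity] end end.
  rewrite <- bsum_opp, <- bsum_add; apply bsum_ext; intros x; destruct (_ =? _); ring.
- intros N HN; unfold divisor_sum; rewrite !bsum_zero; auto.
  + intros [d e] H; b2p; nia.
  + intros [[[a b] c] d] H; apply four_squares_bound in H; lia.
(* Initial value: at [N = 4] each side has exactly one solution, and both equal 1. *)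
- unfold divisor_sum; rewrite (bsum_single (1, 1)), (bsum_single (1, 1, 1, 1)).
  + reflexivity.
  + simpl; lia.
  + intros [[[a b] c] d] H E; exfalso; apply E, (four_squares_bound 4); auto.
  + simpl; lia.
  + intros [d e] H; b2p; intros E; exfalso; apply E; repeat f_equal; nia.
Qed.

(* The signs make both outputs [1 mod 4] when [a = 1 mod 4] and [c] is even. *)
Definition rotate (v : Z * Z) : Z * Z :=
  let '(a, c) := v in if c mod 4 =? 0 then (a + c, a - c) else (c - a, - a - c).

(** The outputs of [rotate] are ordered so that [c] is half their difference in both cases; hence
    the case can be read off from the outputs. *)
Definition unrotate (w : Z * Z) : Z * Z :=
  let '(w1, w2) := w in let c := (w1 - w2) / 2 in
  (if c mod 4 =? 0 then (w1 + w2) / 2 else - ((w1 + w2) / 2), c).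

Lemma rotate_spec a c : a mod 4 = 1 -> c mod 2 = 0 ->
  let '(w1, w2) := rotate (a, c) in
  w1 mod 4 = 1 /\ w2 mod 4 = 1 /\ w1 * w1 + w2 * w2 = 2 * (a * a + c * c) /\
  unrotate (w1, w2) = (a, c).
Proof.
intros Ha Hc; unfold rotate; destruct (Z.eqb_spec (c mod 4) 0) as [E | E];
  unfold unrotate; repeat split; try lia.
- replace ((a + c - (a - c)) / 2) with c by lia.
  rewrite E; simpl; f_equal; lia.
- replace ((c - a - (- a - c)) / 2) with c by lia.
  rewrite <- Z.eqb_neq in E; rewrite E; f_equal; lia.
Qed.

Lemma unrotate_spec w1 w2 : w1 mod 4 = 1 -> w2 mod 4 = 1 ->
  let '(a, c) := unrotate (w1, w2) in
  a mod 4 = 1 /\ c mod 2 = 0 /\ w1 * w1 + w2 * w2 = 2 * (a * a + c * c) /\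
  rotate (a, c) = (w1, w2).
Proof.
intros H1 H2; unfold unrotate.
set (c := (w1 - w2) / 2); set (u := (w1 + w2) / 2).
assert (E1 : w1 = u + c) by lia; assert (E2 : w2 = u - c) by lia.
assert (Hc : c mod 2 = 0) by lia.
clearbody u c; subst.
destruct (c mod 4 =? 0) eqn:E; unfold rotate; rewrite E; b2p; repeat split; try lia;
  f_equal; lia.
Qed.

(** * From three squares to four squares *)

Definition three_squares (N : Z) : Z * Z * Z -> bool :=
  fun '(a, b, c) => (a mod 4 =? 1) && (b mod 4 =? 1) && (c mod 2 =? 0)
    && (a * a + b * b + c * c =? N).

(** The equation is [4 m = 2 (a^2 + c^2) + 2 (b^2 + (2 t)^2)], and [rotate] turns each of the two
    brackets, doubled, into a sum of two squares of integers that are 1 modulo 4. *)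
Lemma three_squares_sum B m :
  0 <= m -> 4 * m + 1 <= B ->
  bsum B (fun _ => true) (fun t => count B (three_squares (2 * (m - 2 * (t * t)))))
  = count B (four_squares (4 * m)).
Proof.
intros Hm HB.
transitivity (count B (fun '(t, v) => three_squares (2 * (m - 2 * (t * t))) v)).
{ rewrite bsum_pair; reflexivity. }
apply (bsum_reindex
  (fun '(t, (a, b, c)) => (rotate (a, c), fst (rotate (b, 2 * t)), snd (rotate (b, 2 * t))))
  (fun '(w1, w2, w3, w4) => let '(a, c) := unrotate (w1, w2) in
     let '(b, s) := unrotate (w3, w4) in (s / 2, (a, b, c)))).
- intros [t [[a b] c]] H; unfold three_squares in H; b2p; simpl.
  destruct H as [_ H].
  pose proof (sqr_bound a); pose proof (sqr_bound b); pose proof (sqr_bound c);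
  pose proof (sqr_bound t); lia.
- intros [[[a b] c] d] H; unfold four_squares in H; b2p; simpl.
  destruct H as [_ H].
  pose proof (sqr_bound a); pose proof (sqr_bound b); pose proof (sqr_bound c);
  pose proof (sqr_bound d); lia.
- intros [t [[a b] c]] H; unfold three_squares in H; b2p.
  pose proof (rotate_spec a c ltac:(tauto) ltac:(tauto)) as R1.
  pose proof (rotate_spec b (2 * t) ltac:(tauto) ltac:(lia)) as R2.
  destruct (rotate (a, c)) as [w1 w2], (rotate (b, 2 * t)) as [w3 w4]; cbn [fst snd].
  destruct R1 as [? [? [? ->]]], R2 as [? [? [? ->]]].
  unfold four_squares; b2p; repeat split; try lia.
  pair_eq.
- intros [[[w1 w2] w3] w4] H; unfold four_squares in H; b2p.
  pose proof (unrotate_spec w1 w2 ltac:(tauto) ltac:(tauto)) as R1.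
  pose proof (unrotate_spec w3 w4 ltac:(tauto) ltac:(tauto)) as R2.
  destruct (unrotate (w1, w2)) as [a c], (unrotate (w3, w4)) as [b s].
  destruct R1 as [? [? [? E1]]], R2 as [? [? [? E2]]].
  replace (2 * (s / 2)) with s by lia; rewrite E1, E2.
  unfold three_squares; b2p; repeat split; try lia.
Qed.

(** * The class number relation *)

(** With [u = 2 p + c] and [v = 2 q + c] the equation reads [u v - c^2 = 2 m]: these are binary
    forms [u X^2 + 2 c X Y + v Y^2] of determinant [2 m]. *)
Definition pqc_triple (m : Z) : Z * Z * Z -> bool :=
  fun '(p, q, c) => (1 <=? p) && (0 <=? q) && (1 <=? c) && (2 * p * q + c * (p + q) =? m).

(* In [2 p q + c (p + q) + 2 t^2 = m] put [N = p + q], [k = t - p] and [j = p]; the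
   pairs [(p, q)] become a window of values of [j] of length [N]. *)
Definition quad_A (m eps : Z) : Z * Z * Z * Z -> bool :=
  fun '(N, k, c, j) => (0 <? N) && (0 <? c) && (0 <? N + 2 * k) && (eps <=? j)
    && (c * N + 2 * j * (N + 2 * k) + 2 * k * k =? m).

(** Common target of the substitutions below. Its equation is invariant under
    [(n, l) -> (n - 2 k, l + i)]. *)
Definition quad_D (m : Z) : Z * Z * Z * Z -> bool :=
  fun '(n, k, i, l) => (0 <? n) && (0 <? k) && (0 <? i) && (0 <=? l)
    && (n * i + 2 * k * l + 2 * k * k =? m).

Lemma mul_bound a b : 0 < a -> 0 <= b -> 0 <= b <= a * b.
Proof. nia. Qed.

Lemma odd_mul a b : (a * b) mod 2 = 1 -> a mod 2 = 1 /\ b mod 2 = 1.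
Proof.
intros H; rewrite Z.mul_mod in H by lia.
assert (Ca : a mod 2 = 0 \/ a mod 2 = 1) by lia.
assert (Cb : b mod 2 = 0 \/ b mod 2 = 1) by lia.
destruct Ca as [Ea | Ea], Cb as [Eb | Eb]; rewrite Ea, Eb in H; easy.
Qed.

Lemma quad_A_in_box B m eps v :
  0 <= eps -> 2 * m <= B -> quad_A m eps v = true -> in_box B v.
Proof.
destruct v as [[[N k] c] j]; unfold quad_A; intros He HB H; b2p; simpl.
pose proof (mul_bound c N); pose proof (mul_bound N c).
pose proof (mul_bound (N + 2 * k) j); pose proof (sqr_bound k); lia.
Qed.

Lemma quad_A_odd m eps N k c j :
  m mod 2 = 1 -> quad_A m eps (N, k, c, j) = true -> N mod 2 = 1 /\ c mod 2 = 1.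
Proof. unfold quad_A; intros Hm H; b2p; apply and_comm, odd_mul; lia. Qed.

Lemma quad_D_in_box B m v : 2 * m <= B -> quad_D m v = true -> in_box B v.
Proof.
destruct v as [[[n k] i] l]; unfold quad_D; intros HB H; b2p; simpl.
pose proof (mul_bound n i); pose proof (mul_bound i n).
pose proof (mul_bound k l); pose proof (sqr_bound k); lia.
Qed.

Lemma quad_D_odd m n k i l :
  m mod 2 = 1 -> quad_D m (n, k, i, l) = true -> n mod 2 = 1 /\ i mod 2 = 1.
Proof. unfold quad_D; intros Hm H; b2p; apply odd_mul; lia. Qed.

Definition window_A (m eps : Z) (v : Z * Z * Z * Z) : bool :=
  quad_A m eps v && (let '(N, k, c, j) := v in j <? N + eps).

(** The sign of [p - q - 2 t] splits the solutions, and 0 is excluded because it would make [m]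
    even. The two halves use [j = q] with [0 <= q < N] and [j = p] with [1 <= p <= N], whence the
    windows for [eps = 0] and [eps = 1]. *)
Lemma pqc_sum_windows B m :
  m mod 2 = 1 -> 2 * m <= B ->
  bsum B (fun _ => true) (fun t => count B (pqc_triple (m - 2 * (t * t))))
  = count B (window_A m 0) + count B (window_A m 1).
Proof.
intros Hm HB.
set (P := fun v : Z * (Z * Z * Z) => let '(t, w) := v in pqc_triple (m - 2 * (t * t)) w).
set (Q := fun v : Z * (Z * Z * Z) => let '(t, (p, q, c)) := v in 0 <? p - q - 2 * t).
transitivity (count B P); [rewrite bsum_pair; reflexivity|].
assert (HP : forall v, P v = true -> in_box B v).
{ intros [t [[p q] c]]; unfold P, pqc_triple; intros H; b2p; simpl.
  pose proof (mul_bound p q); pose proof (mul_bound c (p + q));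
  pose proof (mul_bound (p + q) c); pose proof (sqr_bound t); lia. }
assert (HA : forall eps v, 0 <= eps -> window_A m eps v = true -> in_box B v).
{ intros eps v He H; unfold window_A in H; b2p.
  apply (quad_A_in_box B m eps); tauto. }
rewrite (bsum_split Q); f_equal.
- apply (bsum_reindex (fun '(t, (p, q, c)) => (p + q, - t - q, c, q))
    (fun '(N, k, c, j) => (- (k + j), (N - j, j, c)))).
  + intros v H; b2p; apply HP; tauto.
  + intros v; apply HA; lia.
  + intros [t [[p q] c]]; unfold P, Q, window_A, quad_A, pqc_triple; intros H; b2p.
    repeat split; try lia; pair_eq.
  + intros [[[N k] c] j]; unfold P, Q, window_A, quad_A, pqc_triple; intros H; b2p.
    repeat split; try lia; pair_eq.
- apply (bsum_reindex (fun '(t, (p, q, c)) => (p + q, t - p, c, p))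
    (fun '(N, k, c, j) => (k + j, (j, N - j, c)))).
  + intros v H; b2p; apply HP; tauto.
  + intros v; apply HA; lia.
  + intros [t [[p q] c]]; unfold P, Q, window_A, quad_A, pqc_triple; intros H; b2p.
    assert (p - q - 2 * t <> 0).
    { intros E; assert (Ep : p = q + 2 * t) by lia.
      assert (m = 2 * (p * q + c * (q + t) + t * t)) by (subst p; lia). lia. }
    repeat split; try lia; pair_eq.
  + intros [[[N k] c] j]; unfold P, Q, window_A, quad_A, pqc_triple; intros H; b2p.
    repeat split; try lia; pair_eq.
Qed.

Definition short_D (m eps : Z) (v : Z * Z * Z * Z) : bool :=
  quad_D m v && (let '(n, k, i, l) := v in (n <? 2 * k) && (eps <=? l)).

(** With [K = k + N] and [u = 2 (j - N)] the equation becomes [c N + u (2 K - N) + 2 K^2 = m].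
    Subtracting the smaller of [c] and [u] from the larger gives [i], and the smaller becomes [l].
    Since [c] is odd and [u] even, the parity of [l] tells which case occurred. *)
Lemma outer_A_short_D B m eps :
  m mod 2 = 1 -> 2 * m <= B -> eps = 0 \/ eps = 1 ->
  count B (fun v => quad_A m eps v && negb (let '(N, k, c, j) := v in j <? N + eps))
  = count B (short_D m eps).
Proof.
intros Hm HB He.
apply (bsum_reindex
  (fun '(N, k, c, j) => if 2 * (j - N) <? c
     then (N, k + N, c - 2 * (j - N), 2 * (j - N))
     else (2 * k + N, k + N, 2 * (j - N) - c, c))
  (fun '(n, k, i, l) => if l mod 2 =? 0
     then (n, k - n, i + l, l / 2 + n)
     else (2 * k - n, n - k, l, (i + l) / 2 + (2 * k - n)))).
- intros v H; b2p; apply (quad_A_in_box B m eps); [lia | lia | tauto].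
- intros v H; unfold short_D in H; b2p; apply (quad_D_in_box B m); tauto.
- intros [[[N k] c] j] H; b2p; destruct H as [H1 H2].
  pose proof (quad_A_odd m eps N k c j Hm H1) as [HN Hc].
  unfold quad_A in H1; b2p.
  destruct (Z.ltb_spec (2 * (j - N)) c); unfold short_D, quad_D; b2p.
  + replace ((2 * (j - N)) mod 2) with 0 by lia; simpl Z.eqb.
    repeat split; try lia; pair_eq.
  + replace (c mod 2) with 1 by lia; simpl Z.eqb.
    repeat split; try lia; pair_eq.
- intros [[[n k] i] l] H; unfold short_D in H; b2p; destruct H as [H1 H2].
  pose proof (quad_D_odd m n k i l Hm H1) as [Hn Hi].
  unfold quad_D in H1; b2p.
  destruct (Z.eqb_spec (l mod 2) 0) as [E | E].
  + set (h := l / 2); assert (El : l = 2 * h) by lia; clearbody h; subst l.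
    unfold quad_A; b2p; repeat split; try lia.
    replace (2 * (h + n - n) <? i + 2 * h) with true by lia.
    pair_eq.
  + set (h := (i + l) / 2); assert (El : i = 2 * h - l) by lia; clearbody h; subst i.
    unfold quad_A; b2p; repeat split; try lia.
    replace (2 * (h + (2 * k - n) - (2 * k - n)) <? l) with false by lia.
    pair_eq.
Qed.

Definition closed_D (m eps : Z) (v : Z * Z * Z * Z) : bool :=
  quad_D m v && (let '(n, k, i, l) := v in (eps <=? l) && (l <=? i - eps)).

(** For [k > 0] regroup as [(c + 2 j) N + 2 k (2 j) + 2 k^2]; for [k < 0] put [n = N + 2 k] and
    regroup as [(c + 2 j) n + 2 (- k) c + 2 k^2]. Again [l] is even in the first case and odd in the
    second. *)
Lemma nonzero_A_closed_D B m eps :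
  m mod 2 = 1 -> 2 * m <= B -> eps = 0 \/ eps = 1 ->
  count B (fun v => quad_A m eps v && negb (let '(N, k, c, j) := v in k =? 0))
  = count B (closed_D m eps).
Proof.
intros Hm HB He.
apply (bsum_reindex
  (fun '(N, k, c, j) => if 0 <? k then (N, k, c + 2 * j, 2 * j)
     else (N + 2 * k, - k, c + 2 * j, c))
  (fun '(n, k, i, l) => if l mod 2 =? 0 then (n, k, i - l, l / 2)
     else (n + 2 * k, - k, l, (i - l) / 2))).
- intros v H; b2p; apply (quad_A_in_box B m eps); [lia | lia | tauto].
- intros v H; unfold closed_D in H; b2p; apply (quad_D_in_box B m); tauto.
- intros [[[N k] c] j] H; b2p; destruct H as [H1 H2].
  pose proof (quad_A_odd m eps N k c j Hm H1) as [HN Hc].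
  unfold quad_A in H1; b2p.
  destruct (Z.ltb_spec 0 k); unfold closed_D, quad_D; b2p.
  + replace ((2 * j) mod 2) with 0 by lia; simpl Z.eqb.
    repeat split; try lia; pair_eq.
  + replace (c mod 2) with 1 by lia; simpl Z.eqb.
    repeat split; try lia; pair_eq.
- intros [[[n k] i] l] H; unfold closed_D in H; b2p; destruct H as [H1 H2].
  pose proof (quad_D_odd m n k i l Hm H1) as [Hn Hi].
  unfold quad_D in H1; b2p.
  destruct (Z.eqb_spec (l mod 2) 0) as [E | E].
  + set (h := l / 2); assert (El : l = 2 * h) by lia; clearbody h; subst l.
    unfold quad_A; b2p; repeat split; try lia.
    replace (0 <? k) with true by lia.
    pair_eq.
  + set (h := (i - l) / 2); assert (El : i = 2 * h + l) by lia; clearbody h; subst i.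
    unfold quad_A; b2p; repeat split; try lia.
    replace (0 <? - k) with false by lia.
    pair_eq.
Qed.

Definition half_open_D (m eps : Z) (v : Z * Z * Z * Z) : bool :=
  quad_D m v && (let '(n, k, i, l) := v in (eps <=? l) && (l <? i + eps)).

(** The ranges [[0, i]] and [[1, i - 1]] for [l] together cover the same values, with multiplicity,
    as [[0, i - 1]] and [[1, i]]. *)
Lemma closed_D_half_open_D B m :
  count B (closed_D m 0) + count B (closed_D m 1)
  = count B (half_open_D m 0) + count B (half_open_D m 1).
Proof.
rewrite (bsum_split (fun '(n, k, i, l) => l <? i) _ (closed_D m 0)).
rewrite (bsum_split (fun '(n, k, i, l) => l <? i) _ (half_open_D m 1)).
assert (E1 : count B (fun v => closed_D m 0 v && (let '(n, k, i, l) := v in l <? i))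
             = count B (half_open_D m 0)).
{ apply bsum_ext_pred; intros [[[n k] i] l]; unfold closed_D, half_open_D, quad_D; b2p; lia. }
assert (E2 : count B (fun v => closed_D m 0 v && negb (let '(n, k, i, l) := v in l <? i))
  = count B (fun v => half_open_D m 1 v && negb (let '(n, k, i, l) := v in l <? i))).
{ apply bsum_ext_pred; intros [[[n k] i] l]; unfold closed_D, half_open_D, quad_D; b2p; lia. }
assert (E3 : count B (closed_D m 1)
  = count B (fun v => half_open_D m 1 v && (let '(n, k, i, l) := v in l <? i))).
{ apply bsum_ext_pred; intros [[[n k] i] l]; unfold closed_D, half_open_D, quad_D; b2p; lia. }
lia.
Qed.

(* Euclidean division of [n] by [2 k], with a multiple of [i] moved into [l]. *)
Lemma half_open_D_short_D B m eps :
  m mod 2 = 1 -> 2 * m <= B -> eps = 0 \/ eps = 1 ->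
  count B (half_open_D m eps) = count B (short_D m eps).
Proof.
intros Hm HB He.
apply (bsum_reindex
  (fun '(n, k, i, l) => (n mod (2 * k), k, i, l + i * (n / (2 * k))))
  (fun '(n, k, i, l) => (n + 2 * k * ((l - eps) / i), k, i, eps + (l - eps) mod i))).
- intros v H; unfold half_open_D in H; b2p; apply (quad_D_in_box B m); tauto.
- intros v H; unfold short_D in H; b2p; apply (quad_D_in_box B m); tauto.
- intros [[[n k] i] l] H; unfold half_open_D in H; b2p; destruct H as [H1 H2].
  pose proof (quad_D_odd m n k i l Hm H1) as [Hn Hi].
  unfold quad_D in H1; b2p.
  pose proof (Z.div_mod n (2 * k) ltac:(lia)) as E.
  pose proof (Z.mod_pos_bound n (2 * k) ltac:(lia)) as Hr.
  pose proof (Z.div_pos n (2 * k) ltac:(lia) ltac:(lia)) as Hq.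
  set (q := n / (2 * k)) in *; set (r := n mod (2 * k)) in *; clearbody q r.
  (* [n] is odd, so its remainder modulo [2 k] is positive, as [quad_D] demands. *)
  assert (r <> 0) by (intros ->; assert (n = 2 * (k * q)) by lia; lia).
  assert (0 <= i * q) by nia.
  assert (Eq : (l + i * q - eps) / i = q) by (symmetry; apply (Z.div_unique _ _ _ (l - eps)); lia).
  assert (Er : (l + i * q - eps) mod i = l - eps) by (symmetry; apply (Z.mod_unique _ _ q); lia).
  rewrite Eq, Er; unfold short_D, quad_D; b2p; clear Eq Er Hn Hi.
  subst n; repeat split; try lia; pair_eq.
- intros [[[n k] i] l] H; unfold short_D in H; b2p; destruct H as [H1 H2].
  pose proof (quad_D_odd m n k i l Hm H1) as [Hn Hi].
  unfold quad_D in H1; b2p.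
  pose proof (Z.div_mod (l - eps) i ltac:(lia)) as E.
  pose proof (Z.mod_pos_bound (l - eps) i ltac:(lia)) as Hr.
  pose proof (Z.div_pos (l - eps) i ltac:(lia) ltac:(lia)) as Hq.
  set (q := (l - eps) / i) in *; set (r := (l - eps) mod i) in *; clearbody q r.
  assert (0 <= k * q) by nia.
  assert (Eq : (n + 2 * k * q) / (2 * k) = q) by (symmetry; apply (Z.div_unique _ _ _ n); lia).
  assert (Er : (n + 2 * k * q) mod (2 * k) = n) by (symmetry; apply (Z.mod_unique _ _ q); lia).
  rewrite Eq, Er; unfold half_open_D, quad_D; b2p; clear Eq Er Hn Hi.
  assert (l = eps + r + i * q) by lia; subst l.
  repeat split; try lia; pair_eq.
Qed.

(** * Evaluation of the class number sum *)

Lemma count_below B d : 0 <= d <= B -> count B (fun r => (0 <=? r) && (r <? d)) = d.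
Proof.
intros [H0 H1]; revert H1; pattern d; apply natlike_ind; [|clear d H0|exact H0].
- intros _; apply bsum_zero; intros x H; b2p; lia.
- intros d Hd IH HB.
  rewrite (bsum_split (fun r => r <? d)).
  rewrite (bsum_ext_pred _ _ (fun r => (0 <=? r) && (r <? d))), IH by (intros; b2p; lia).
  rewrite (bsum_single d); [| simpl; lia | intros; b2p; lia].
  replace ((0 <=? d) && (d <? Z.succ d) && negb (d <? d)) with true; [lia|].
  symmetry; b2p; lia.
Qed.

(** At [k = 0] the equation is [N (c + 2 j) = m]. For a factorisation with [d = c + 2 j], the values
    [2 j] for [eps = 0] and [2 j - 1] for [eps = 1] run through the even and the odd [r] in
    [[0, d)], so it is counted [d] times. *)
Lemma zero_A_divisor_sum B m :
  m mod 2 = 1 -> 0 < m -> 2 * m <= B ->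
  count B (fun v => quad_A m 0 v && (let '(N, k, c, j) := v in k =? 0))
  + count B (fun v => quad_A m 1 v && (let '(N, k, c, j) := v in k =? 0))
  = divisor_sum B (4 * m).
Proof.
intros Hm Hm0 HB.
set (P := fun v : Z * Z * Z => let '(d, e, r) := v in
  (0 <? d) && (0 <? e) && (4 * d * e =? 4 * m) && ((0 <=? r) && (r <? d))).
assert (HP : forall v, P v = true -> in_box B v).
{ intros [[d e] r]; unfold P; intros H; b2p; simpl.
  pose proof (mul_bound d e); pose proof (mul_bound e d); lia. }
transitivity (count B P).
- rewrite (bsum_split (fun '(d, e, r) => r mod 2 =? 0) _ P); f_equal.
  + apply (bsum_reindex (fun '(N, k, c, j) => (c + 2 * j, N, 2 * j))
      (fun '(d, e, r) => (e, 0, d - r, r / 2))).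
    * intros v H; b2p; apply (quad_A_in_box B m 0); [lia | lia | tauto].
    * intros v H; b2p; apply HP; tauto.
    * intros [[[N k] c] j]; unfold quad_A, P; intros H; b2p.
      assert (k = 0) by tauto; subst k.
      repeat split; try lia; pair_eq.
    * intros [[d e] r]; unfold quad_A, P; intros H; b2p.
      set (h := r / 2); assert (r = 2 * h) by lia; clearbody h; subst r.
      repeat split; try lia; pair_eq.
  + apply (bsum_reindex (fun '(N, k, c, j) => (c + 2 * j, N, 2 * j - 1))
      (fun '(d, e, r) => (e, 0, d - r - 1, (r + 1) / 2))).
    * intros v H; b2p; apply (quad_A_in_box B m 1); [lia | lia | tauto].
    * intros v H; b2p; apply HP; tauto.
    * intros [[[N k] c] j]; unfold quad_A, P; intros H; b2p.
      assert (k = 0) by tauto; subst k.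
      repeat split; try lia; pair_eq.
    * intros [[d e] r]; unfold quad_A, P; intros H; b2p.
      (* For [d] odd, an odd [r < d] is at most [d - 2], which keeps [c = d - r - 1] positive. *)
      assert (d mod 2 = 1) by (apply (odd_mul d e); lia).
      set (h := (r + 1) / 2); assert (r = 2 * h - 1) by lia; clearbody h; subst r.
      repeat split; try lia; pair_eq.
- rewrite bsum_pair; apply bsum_ext; intros [d e].
  destruct ((0 <? d) && (0 <? e) && (4 * d * e =? 4 * m)) eqn:E; unfold P; rewrite E.
  + apply count_below; b2p; pose proof (mul_bound e d); lia.
  + apply bsum_zero; discriminate.
Qed.

(** The solutions of [quad_A] are split in two ways: inside or outside the window, and by [k = 0] or
    not. Summed over [eps], the part outside the window and the part with [k <> 0] have equal
    counts, so the remaining parts do too. *)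
Lemma pqc_sum_divisor_sum B m :
  m mod 2 = 1 -> 0 < m -> 2 * m <= B ->
  bsum B (fun _ => true) (fun t => count B (pqc_triple (m - 2 * (t * t))))
  = divisor_sum B (4 * m).
Proof.
intros Hm Hm0 HB.
rewrite pqc_sum_windows, <- zero_A_divisor_sum by assumption.
pose proof (closed_D_half_open_D B m) as E.
assert (K : forall eps, eps = 0 \/ eps = 1 ->
  count B (window_A m eps) + count B (half_open_D m eps) =
  count B (fun v => quad_A m eps v && (let '(N, k, c, j) := v in k =? 0))
  + count B (closed_D m eps)).
{ intros eps He.
  rewrite half_open_D_short_D, <- outer_A_short_D by assumption.
  rewrite <- nonzero_A_closed_D by assumption.
  rewrite <- bsum_split.
  symmetry; apply (bsum_split (fun '(N, k, c, j) => j <? N + eps)). }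
pose proof (K 0 ltac:(lia)); pose proof (K 1 ltac:(lia)); lia.
Qed.

(** Both counts have the same sum over [t]. The terms with [t <> 0] concern the smaller odd numbers
    [m - 2 t^2] and agree by induction, which leaves [t = 0]. *)
Lemma three_squares_pqc B m :
  5 <= B -> m mod 2 = 1 -> 4 * m + 1 <= B ->
  count B (three_squares (2 * m)) = count B (pqc_triple m).
Proof.
intros HB5.
assert (Hneg : forall m, m <= 0 -> count B (three_squares (2 * m)) = 0 /\ count B (pqc_triple m) = 0).
{ clear m; intros m Hm; split; apply bsum_zero.
  - intros [[a b] c] H; unfold three_squares in H; b2p.
    pose proof (sqr_mod4_bound a); pose proof (sqr_bound b); pose proof (sqr_bound c); lia.
  - intros [[p q] c] H; unfold pqc_triple in H; b2p.
    pose proof (mul_bound p q); pose proof (mul_bound c (p + q)); lia. }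
destruct (Z.le_gt_cases m 0) as [Hm | Hm].
{ intros; destruct (Hneg m Hm) as [-> ->]; reflexivity. }
assert (Hm0 : 0 <= m) by lia; revert Hm.
pattern m; apply Zlt_0_ind; [clear m Hm0; intros m IH _ Hm Hodd HB | exact Hm0].
pose proof (three_squares_sum B m ltac:(lia) HB) as E.
rewrite four_squares_divisor_sum, <- pqc_sum_divisor_sum in E by lia.
assert (D : bsum B (fun _ => true) (fun t => count B (three_squares (2 * (m - 2 * (t * t))))
            + - count B (pqc_triple (m - 2 * (t * t)))) = 0)
  by (rewrite bsum_add, bsum_opp; lia).
rewrite (bsum_single 0) in D; [| simpl; lia |].
- replace (m - 2 * (0 * 0)) with m in D by lia; lia.
- intros t _ Ht.
  assert (1 <= t * t) by nia.
  destruct (Z.le_gt_cases (m - 2 * (t * t)) 0) as [Ht0 | Ht0].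
  + destruct (Hneg _ Ht0) as [-> ->]; reflexivity.
  + rewrite IH by lia; lia.
Qed.

Lemma odd_as_sum m :
  m mod 2 = 1 -> 0 < m ->
  exists x y z, m = x * x + 2 * (y * y) + 4 * (z * z) /\ x mod 2 = 1.
Proof.
intros Hm Hm0; set (B := 4 * m + 1).
destruct (count_witness B (three_squares (2 * m))) as [[[a b] c] H].
{ rewrite three_squares_pqc by lia.
  apply (count_pos (1, 0, m)); [simpl; lia | unfold pqc_triple; b2p; lia]. }
unfold three_squares in H; b2p.
(* From [a = x + 2 z] and [b = x - 2 z] one gets [a^2 + b^2 = 2 x^2 + 8 z^2]; [x] is odd because [a]
   and [b] are 1 modulo 4. *)
set (x := (a + b) / 2); set (z := (a - b) / 4); set (y := c / 2).
assert (Ea : a = x + 2 * z) by lia; assert (Eb : b = x - 2 * z) by lia.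
assert (Ec : c = 2 * y) by lia.
exists x, y, z; split; [|lia].
clearbody x y z; subst; lia.
Qed.

(** * The coefficients and the final representation *)

Lemma sqr_small x : x ^ 2 = 0 \/ x ^ 2 = 1 \/ 4 <= x ^ 2.
Proof.
assert (C : x = 0 \/ x = 1 \/ x = -1 \/ 2 <= x \/ x <= -2) by lia.
destruct C as [-> | [-> | [-> | C]]]; auto; right; right; nia.
Qed.

Lemma small_values a b x y z w : 0 < a -> a <= b ->
  (f4 a b x y z w = 1 -> a = 1) /\
  (f4 1 b x y z w = 2 -> b <= 2) /\
  f4 1 1 x y z w <> 3.
Proof.
unfold f4; intros ha hab.
assert (L : 0 <= z ^ 2 + z * w + w ^ 2) by nia.
pose proof (mul_bound a (x ^ 2)); pose proof (mul_bound b (y ^ 2)).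
destruct (sqr_small x) as [X | [X | X]], (sqr_small y) as [Y | [Y | Y]];
  generalize dependent (z ^ 2 + z * w + w ^ 2);
  generalize dependent (x ^ 2); generalize dependent (y ^ 2);
  intros; subst; repeat split; lia.
Qed.

Lemma coefficients (a b : Z) :
  0 < a -> a <= b -> represents a b 1 -> represents a b 2 -> represents a b 3 ->
  a = 1 /\ b = 2.
Proof.
intros ha hab [x1 [y1 [z1 [w1 E1]]]] [x2 [y2 [z2 [w2 E2]]]] [x3 [y3 [z3 [w3 E3]]]].
apply small_values in E1; [subst a | lia | lia].
apply (small_values 1) in E2; [| lia | lia].
assert (C : b = 1 \/ b = 2) by lia; destruct C as [-> | ->]; [exfalso | auto].
apply (small_values 1 1 x3 y3 z3 w3 ha hab), E3.
Qed.

Theorem theorem6p4 (a b : Z) (ha : 0 < a) (hab : a <= b)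
  (h1 : represents a b 1) (h2 : represents a b 2) (h3 : represents a b 3) :
  forall n : Z, 0 <= n -> represents a b n.
Proof.
destruct (coefficients a b ha hab h1 h2 h3) as [-> ->].
intros n Hn; unfold represents, f4.
destruct (Z.eq_dec (n mod 2) 1) as [Hodd | Heven].
- destruct (odd_as_sum n Hodd ltac:(lia)) as [x [y [z [-> _]]]].
  exists x, y, z, 0; ring.
- assert (C : n = 0 \/ n = 2 \/ 0 < n - 3) by lia; destruct C as [-> | [-> | Hn3]].
  + exists 0, 0, 0, 0; reflexivity.
  + exists 0, 1, 0, 0; reflexivity.
  + destruct (odd_as_sum (n - 3) ltac:(lia) Hn3) as [x [y [z [E Hx]]]].
    set (h := (x - 1) / 2); assert (x = 2 * h + 1) by lia; clearbody h; subst x.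
    (* Here [4 (h^2 + h + 1) = (2 h + 1)^2 + 3] absorbs the odd square and the 3, while [4 z^2]
       becomes the square of the first variable. *)
    exists (2 * z), y, h, 1; lia.
Qed.
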